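(* Let $\mathsf{X}$ be a subshift over an alphabet $\mathscr{A}$, let $R$ be a commutative unital ring, and let $x\in\mathsf{X}$. Then $\mathrm{End}_{\widetilde{\mathcal{A}}_R(\mathsf{X})}(\mathbb{P}_{[x]})$, the set of all $\widetilde{\mathcal{A}}_R(\mathsf{X})$-module homomorphisms $\mathbb{P}_{[x]}\to\mathbb{P}_{[x]}$, is isomorphic to $R$ (as an $R$-algebra).
   Context: $\mathbb{N}=\{0,1,2,\dots\}$. $\mathscr{A}$ is an arbitrary non-empty set (alphabet); $\sigma:\mathscr{A}^{\mathbb{N}}\to\mathscr{A}^{\mathbb{N}}$ is the shift $\sigma(x_1x_2x_3\dots)=x_2x_3\dots$. $\mathscr{A}^*$ is the set of finite words, including the empty word $\omega$. For $F\subseteq\mathscr{A}^*$, the subshift $\mathsf{X}=\mathsf{X}_F$ is the set of all sequences in $\mathscr{A}^{\mathbb{N}}$ no finite (contiguous) subword of which belongs to $F$. The language $\mathcal{L}_{\mathsf{X}}$ is the set of all finite words (including $\omega$) appearing in some element of $\mathsf{X}$. For $\alpha,\beta\in\mathcal{L}_{\mathsf{X}}$ let $C(\alpha,\beta)=\{\beta x\in\mathsf{X}:\alpha x\in\mathsf{X}\}$. $\mathcal{U}$ is the Boolean algebra of subsets of $\mathsf{X}$ generated by all $C(\alpha,\beta)$, $\alpha,\beta\in\mathcal{L}_{\mathsf{X}}$ (finite unions, finite intersections, complements in $\mathsf{X}$). The unital subshift algebra $\widetilde{\mathcal{A}}_R(\mathsf{X})$ is the universal unital $R$-algebra with generators $\{p_A:A\in\mathcal{U}\}$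 and $\{s_a,s_a^*:a\in\mathscr{A}\}$ subject to: (i) $p_{\mathsf{X}}=1$, $p_{A\cap B}=p_Ap_B$, $p_{A\cup B}=p_A+p_B-p_{A\cap B}$, $p_\emptyset=0$ for all $A,B\in\mathcal{U}$; (ii) $s_as_a^*s_a=s_a$ and $s_a^*s_as_a^*=s_a^*$ for all $a\in\mathscr{A}$; (iii) $s_\beta s_\alpha^*s_\alpha s_\beta^*=p_{C(\alpha,\beta)}$ for all $\alpha,\beta\in\mathcal{L}_{\mathsf{X}}$, where $s_\omega=s_\omega^*=1$ and, for $\alpha=\alpha_1\cdots\alpha_n$, $s_\alpha=s_{\alpha_1}\cdots s_{\alpha_n}$, $s_\alpha^*=s_{\alpha_n}^*\cdots s_{\alpha_1}^*$. $\mathbb{P}$ is the free $R$-module with basis $\{\delta_x:x\in\mathsf{X}\}$. For a statement $p$, $[p]=1$ if $p$ is true and $[p]=0$ otherwise. $\pi:\widetilde{\mathcal{A}}_R(\mathsf{X})\to\mathrm{End}_R(\mathbb{P})$ is the unique $R$-algebra homomorphism with $\pi(p_A)=P_A$, $\pi(s_a)=S_a$, $\pi(s_a^* )=S_a^*$ for $A\in\mathcal{U}$, $a\in\mathscr{A}$, where for $x=x_1x_2x_3\dots\in\mathsf{X}$: $P_A(\delta_x)=[x\in A]\,\delta_x$, $S_a(\delta_x)=[ax\in\mathsf{X}]\,\delta_{ax}$, $S_a^*(\delta_x)=[x_1=a]\,\delta_{\sigma(x)}$ (the value being $0$ when the bracket is $0$). For $x,y\in\mathsf{X}$ write $x\sim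 y$ if $\sigma^n(x)=\sigma^m(y)$ for some $n,m\in\mathbb{N}$; this is an equivalence relation, and the class of $x$ is also denoted $[x]$. $\mathbb{P}_{[x]}$ is the $R$-submodule of $\mathbb{P}$ generated by $\{\delta_y:y\in[x]\}$. It is invariant under $\pi(\widetilde{\mathcal{A}}_R(\mathsf{X}))$, hence a left $\widetilde{\mathcal{A}}_R(\mathsf{X})$-module via $\mu\cdot z=\pi(\mu)(z)$. *)

(* Defs.v *)
From HB Require Import structures.
From mathcomp Require Import all_boot all_algebra.
From mathcomp Require Import finmap monalg.
From mathcomp Require Import boolp classical_sets.

Set Implicit Arguments.
Unset Strict Implicit.
Unset Printing Implicit Defensive.
Set Warnings "-redundant-canonical-projection".

Import GRing.Theory.

Local Open Scope ring_scope.
Local Open Scope classical_set_scope.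
Local Open Scope quotient_scope.

(* MathComp's algType excludes the zero ring.  Here R may be zero, and the    *)
(* algebra of a subshift is presented by generators and relations without     *)
(* knowing beforehand that 1 != 0.  A unital associative algebra over a       *)
(* commutative ring R is therefore taken to be a pzRingType V with a ring     *)
(* morphism from R to the centre of V; r in R acts on V as alg_const r.       *)
HB.mixin Record isPzAlgebra (R : comPzRingType) V of GRing.PzRing V := {
  alg_const : R -> V;
  alg_const_add : {morph alg_const : r s / r + s};
  alg_const_monoid : monoid_morphism alg_const;
  alg_const_central : forall (r : R) (x : V),
    alg_const r * x = x * alg_const r
}.

#[short(type="pzAlgType")]
HB.structure Definition PzAlgebra (R : comPzRingType) :=
  {V of GRing.PzRing V & isPzAlgebra R V}.

Section SelfAlgebra.
Variable R : comPzRingType.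

HB.instance Definition _ := isPzAlgebra.Build R (R : Type)
  (fun _ _ => erefl) (conj erefl (fun _ _ => erefl)) (@mulrC R).

End SelfAlgebra.

(* A ring morphism f is R-linear if and only if it commutes with alg_const.   *)
Definition algebra_morphism (R : comPzRingType) (A B : pzAlgType R)
    (f : {rmorphism A -> B}) : Prop :=
  forall r : R, f (alg_const r) = alg_const r.

Definition algebra_isomorphic (R : comPzRingType) (A B : pzAlgType R) : Prop :=
  exists f : {rmorphism A -> B}, algebra_morphism f /\ bijective f.

Section PzAlgebraTheory.
Variables (R : comPzRingType) (A : pzAlgType R).

Lemma alg_const1 : alg_const 1 = 1 :> A.
Proof. exact: (alg_const_monoid : monoid_morphism (@alg_const R A)).1. Qed.

Lemma alg_constM (r s : R) : alg_const (r * s) = alg_const r * alg_const s :> A.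
Proof. exact: (alg_const_monoid : monoid_morphism (@alg_const R A)).2. Qed.

Lemma alg_const0 : alg_const 0 = 0 :> A.
Proof. by apply: (addrI (alg_const 0)); rewrite -alg_const_add !addr0. Qed.

End PzAlgebraTheory.

(* End_A(M) for a left A-module M: the product is composition and r in R      *)
(* acts on M as alg_const r does.                                             *)
Section ModuleEnd.
Variables (R : comPzRingType) (A : pzAlgType R) (M : lmodType A).

Definition module_end : Type := {linear M -> M}.

HB.instance Definition _ := gen_eqMixin module_end.
HB.instance Definition _ := gen_choiceMixin module_end.

Implicit Types f g h : module_end.

Definition end_app f (z : M) : M := (f : {linear M -> M}) z.
Arguments end_app : simpl never.

Lemma module_endP f g : (forall z, end_app f z = end_app g z) -> f = g.
Proof.
case: f g => [f [[f1] [f2]]] [g [[g1] [g2]]]; rewrite /end_app /= => fg.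
have {}fg : f = g by apply: funext.
case: _ / fg g1 g2 => g1 g2.
by rewrite (Prop_irrelevance f1 g1) (Prop_irrelevance f2 g2).
Qed.

Definition mk_end (f : M -> M) (fL : linear f) : module_end :=
  HB.pack_for {linear M -> M} f (GRing.isLinear.Build A M M *:%R f fL).

Lemma mk_endE f fL z : end_app (@mk_end f fL) z = f z.
Proof. by []. Qed.

Lemma end_appP f : linear (end_app f).
Proof. by move=> a u v; rewrite /end_app linearP. Qed.

HB.instance Definition _ f :=
  GRing.isLinear.Build A M M *:%R (end_app f) (end_appP f).

Fact end_zero_subproof : linear (fun _ : M => 0 : M).
Proof. by move=> a u v; rewrite scaler0 addr0. Qed.
Definition end_zero := mk_end end_zero_subproof.

Fact end_one_subproof : linear (fun z : M => z).
Proof. by []. Qed.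
Definition end_one := mk_end end_one_subproof.

Fact end_opp_subproof f : linear (fun z => - end_app f z).
Proof. by move=> a u v; rewrite end_appP opprD scalerN. Qed.
Definition end_opp f := mk_end (end_opp_subproof f).

Fact end_add_subproof f g : linear (fun z => end_app f z + end_app g z).
Proof. by move=> a u v; rewrite !end_appP scalerDr addrACA. Qed.
Definition end_add f g := mk_end (end_add_subproof f g).

Fact end_mul_subproof f g : linear (fun z => end_app f (end_app g z)).
Proof. by move=> a u v; rewrite !end_appP. Qed.
Definition end_mul f g := mk_end (end_mul_subproof f g).

Fact end_const_subproof (r : R) : linear (fun z : M => (alg_const r : A) *: z).
Proof. by move=> a u v; rewrite scalerDr !scalerA alg_const_central. Qed.
Definition end_const (r : R) := mk_end (end_const_subproof r).

Fact end_zeroE z : end_app end_zero z = 0. Proof. by []. Qed.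
Fact end_oneE z : end_app end_one z = z. Proof. by []. Qed.
Fact end_oppE f z : end_app (end_opp f) z = - end_app f z. Proof. by []. Qed.
Fact end_addE f g z : end_app (end_add f g) z = end_app f z + end_app g z.
Proof. by []. Qed.
Fact end_mulE f g z : end_app (end_mul f g) z = end_app f (end_app g z).
Proof. by []. Qed.
Fact end_constE r z : end_app (end_const r) z = (alg_const r : A) *: z.
Proof. by []. Qed.
Let endE := (end_zeroE, end_oneE, end_oppE, end_addE, end_mulE, end_constE).

Fact end_addA : associative end_add.
Proof. by move=> f g h; apply: module_endP => z; rewrite !endE addrA. Qed.
Fact end_addC : commutative end_add.
Proof. by move=> f g; apply: module_endP => z; rewrite !endE addrC. Qed.
Fact end_add0 : left_id end_zero end_add.
Proof. by move=> f; apply: module_endP => z; rewrite !endE add0r. Qed.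
Fact end_addN : left_inverse end_zero end_opp end_add.
Proof. by move=> f; apply: module_endP => z; rewrite !endE addNr. Qed.

HB.instance Definition _ :=
  GRing.isZmodule.Build module_end end_addA end_addC end_add0 end_addN.

Fact end_mulA : associative end_mul.
Proof. by move=> f g h; apply: module_endP => z; rewrite !endE. Qed.
Fact end_mul1 : left_id end_one end_mul.
Proof. by move=> f; apply: module_endP => z; rewrite !endE. Qed.
Fact end_mulr1 : right_id end_one end_mul.
Proof. by move=> f; apply: module_endP => z; rewrite !endE. Qed.
Fact end_mulDl : left_distributive end_mul +%R.
Proof. by move=> f g h; apply: module_endP => z; rewrite !endE. Qed.
Fact end_mulDr : right_distributive end_mul +%R.
Proof.
move=> f g h; apply: module_endP => z; rewrite !endE.
by have := end_appP f 1 (end_app g z) (end_app h z); rewrite !scale1r.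
Qed.

HB.instance Definition _ := GRing.Zmodule_isPzRing.Build module_end
  end_mulA end_mul1 end_mulr1 end_mulDl end_mulDr.

Fact end_const_add : {morph end_const : r s / r + s}.
Proof.
by move=> r s; apply: module_endP => z; rewrite endE alg_const_add scalerDl.
Qed.
Fact end_const_monoid : monoid_morphism end_const.
Proof.
split=> [|r s]; apply: module_endP => z; rewrite !endE.
  by rewrite alg_const1 scale1r.
by rewrite alg_constM scalerA.
Qed.
Fact end_const_central r f : end_const r * f = f * end_const r.
Proof.
apply: module_endP => z; rewrite !endE.
exact/esym/(linearZ_LR (f : {linear M -> M})).
Qed.

HB.instance Definition _ := isPzAlgebra.Build R module_end
  end_const_add end_const_monoid end_const_central.

Lemma end0E z : end_app (0 : module_end) z = 0. Proof. by []. Qed.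
Lemma end1E z : end_app (1 : module_end) z = z. Proof. by []. Qed.
Lemma endNE f z : end_app (- f) z = - end_app f z. Proof. by []. Qed.
Lemma endDE f g z : end_app (f + g) z = end_app f z + end_app g z.
Proof. by []. Qed.
Lemma endME f g z : end_app (f * g) z = end_app f (end_app g z).
Proof. by []. Qed.
Lemma endCE (r : R) z :
  end_app (alg_const r : module_end) z = (alg_const r : A) *: z.
Proof. by []. Qed.

End ModuleEnd.

Arguments end_app {R A M} f z : simpl never.

(* The free R-module with basis K, with additive group that of {malg R[K]}:   *)
(* finitely supported families, << r *g k >> being r at k and 0 elsewhere.    *)
Section FreeModule.
Variables (R : comPzRingType) (K : choiceType).

Definition free_module : Type := {malg R[K]}.

HB.instance Definition _ := GRing.Zmodule.on free_module.

Implicit Types p q : free_module.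

Definition free_coef (k : K) p : R := mcoeff k p.

Lemma free_coefD k p q : free_coef k (p + q) = free_coef k p + free_coef k q.
Proof. exact: mcoeffD. Qed.

Lemma free_moduleP p q : (forall k, free_coef k p = free_coef k q) -> p = q.
Proof. by move=> pq; apply/malgP. Qed.

Definition free_scale (r : R) p : free_module :=
  \sum_(k <- msupp p) << r * p@_k *g k >>.

Lemma free_scaleE r p k : free_coef k (free_scale r p) = r * free_coef k p.
Proof.
rewrite /free_coef {2}[p]monalgE !raddf_sum mulr_sumr.
by apply/eq_bigr=> /= i _; rewrite !mcoeffU mulrnAr.
Qed.

Fact free_scaleA r s p : free_scale r (free_scale s p) = free_scale (r * s) p.
Proof. by apply: free_moduleP => k; rewrite !free_scaleE mulrA. Qed.
Fact free_scale1 : left_id 1 free_scale.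
Proof. by move=> p; apply: free_moduleP => k; rewrite free_scaleE mul1r. Qed.
Fact free_scaleDr : right_distributive free_scale +%R.
Proof.
move=> r p q; apply: free_moduleP => k.
by rewrite !(free_coefD, free_scaleE) mulrDr.
Qed.
Fact free_scaleDl p r s : free_scale (r + s) p = free_scale r p + free_scale s p.
Proof.
by apply: free_moduleP => k; rewrite !(free_coefD, free_scaleE) mulrDl.
Qed.

HB.instance Definition _ := GRing.Zmodule_isLmodule.Build R free_module
  free_scaleA free_scale1 free_scaleDr free_scaleDl.

Definition delta (k : K) : free_module := << 1 *g k >>.

Lemma free_coefZ r p k : free_coef k (r *: p) = r * free_coef k p.
Proof. exact: free_scaleE. Qed.

Lemma free_coef_delta k l : free_coef k (delta l) = (l == k)%:R.
Proof. exact: mcoeffU. Qed.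

Lemma free_expand p : p = \sum_(k <- msupp p) free_coef k p *: delta k.
Proof.
rewrite {1}[p]monalgE; apply: eq_bigr => k _; apply: free_moduleP => l.
rewrite free_coefZ free_coef_delta /free_coef mcoeffU.
by rewrite mulr_natr.
Qed.

Variable M : lmodType R.

Definition free_ext (f : K -> M) (p : free_module) : M :=
  \sum_(k <- msupp p) free_coef k p *: f k.

Lemma free_extw (f : K -> M) (p : free_module) (d : {fset K}) :
  (msupp p `<=` d)%fset -> free_ext f p = \sum_(k <- d) free_coef k p *: f k.
Proof.
move=> sub; rewrite /free_ext (big_fset_incl _ sub) //= => k _ kNp.
by rewrite /free_coef mcoeff_outdom // scale0r.
Qed.

Lemma free_ext_linear (f : K -> M) : linear (free_ext f).
Proof.
move=> r p q; pose d := (msupp p `|` msupp q `|` msupp (r *: p + q))%fset.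
rewrite !(@free_extw f _ d) ?fsubsetUr //.
- rewrite scaler_sumr -big_split /=; apply: eq_bigr => k _.
  by rewrite free_coefD free_coefZ scalerDl scalerA.
- exact: fsubset_trans (fsubsetUr _ _) (fsubsetUl _ _).
- exact: fsubset_trans (fsubsetUl _ _) (fsubsetUl _ _).
Qed.

Lemma free_ext_delta (f : K -> M) k : free_ext f (delta k) = f k.
Proof.
rewrite (@free_extw f _ [fset k]%fset) ?msuppU_le //.
by rewrite big_seq_fset1 free_coef_delta eqxx scale1r.
Qed.

End FreeModule.

(* The universal unital R-algebra on generators G with the relations          *)
(* t = u, (t, u) in rel: terms modulo the least congruence that contains rel  *)
(* and validates the axioms of unital associative R-algebras.                 *)
Section Presentation.
Variables (R : comPzRingType) (G : Type).

Inductive alg_term : Type :=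
| TGen of G
| TConst of R
| TOpp of alg_term
| TAdd of alg_term & alg_term
| TMul of alg_term & alg_term.

HB.instance Definition _ := gen_eqMixin alg_term.
HB.instance Definition _ := gen_choiceMixin alg_term.

Fixpoint term_eval (B : pzAlgType R) (v : G -> B) (t : alg_term) : B :=
  match t with
  | TGen g => v g
  | TConst r => alg_const r
  | TOpp t => - term_eval v t
  | TAdd t u => term_eval v t + term_eval v u
  | TMul t u => term_eval v t * term_eval v u
  end.

Variable rel : alg_term -> alg_term -> Prop.

Inductive term_cong : alg_term -> alg_term -> Prop :=
| cong_rel t u : rel t u -> term_cong t u
| cong_refl t : term_cong t t
| cong_sym t u : term_cong t u -> term_cong u t
| cong_trans t u w : term_cong t u -> term_cong u w -> term_cong t w
| cong_opp t u : term_cong t u -> term_cong (TOpp t) (TOpp u)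
| cong_add t u t' u' : term_cong t u -> term_cong t' u' ->
    term_cong (TAdd t t') (TAdd u u')
| cong_mul t u t' u' : term_cong t u -> term_cong t' u' ->
    term_cong (TMul t t') (TMul u u')
| cong_addA t u w : term_cong (TAdd t (TAdd u w)) (TAdd (TAdd t u) w)
| cong_addC t u : term_cong (TAdd t u) (TAdd u t)
| cong_add0 t : term_cong (TAdd (TConst 0) t) t
| cong_addN t : term_cong (TAdd (TOpp t) t) (TConst 0)
| cong_mulA t u w : term_cong (TMul t (TMul u w)) (TMul (TMul t u) w)
| cong_1mul t : term_cong (TMul (TConst 1) t) t
| cong_mulDl t u w :
    term_cong (TMul (TAdd t u) w) (TAdd (TMul t w) (TMul u w))
| cong_mulDr t u w :
    term_cong (TMul t (TAdd u w)) (TAdd (TMul t u) (TMul t w))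
| cong_constD r s : term_cong (TConst (r + s)) (TAdd (TConst r) (TConst s))
| cong_constM r s : term_cong (TConst (r * s)) (TMul (TConst r) (TConst s))
| cong_constC r t : term_cong (TMul (TConst r) t) (TMul t (TConst r)).

Definition term_congb (t u : alg_term) : bool := `[< term_cong t u >].

Fact term_congb_refl : reflexive term_congb.
Proof. by move=> t; apply/asboolP/cong_refl. Qed.
Fact term_congb_sym : symmetric term_congb.
Proof. by move=> t u; apply/asboolP/asboolP => /cong_sym. Qed.
Fact term_congb_trans : transitive term_congb.
Proof.
by move=> u t w /asboolP tu /asboolP uw; apply/asboolP/(cong_trans tu).
Qed.

Canonical term_equiv :=
  EquivRel term_congb term_congb_refl term_congb_sym term_congb_trans.

Definition presented_alg : Type := {eq_quot term_equiv}.

HB.instance Definition _ := Choice.on presented_alg.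

Definition pclass (t : alg_term) : presented_alg := \pi_{eq_quot term_equiv} t.
Definition prepr (x : presented_alg) : alg_term :=
  repr (x : {eq_quot term_equiv}).

Lemma pclassP t u : pclass t = pclass u <-> term_cong t u.
Proof.
split=> [/eqmodP/asboolP//|tu].
by apply/eqmodP/asboolP.
Qed.

Lemma preprK x : pclass (prepr x) = x.
Proof. exact: reprK. Qed.

Lemma prepr_cong t : term_cong (prepr (pclass t)) t.
Proof. by apply/pclassP; rewrite preprK. Qed.

Lemma presented_ind (Q : presented_alg -> Prop) :
  (forall t, Q (pclass t)) -> forall x, Q x.
Proof. by move=> Qt x; rewrite -[x]preprK. Qed.

Definition p_opp x := pclass (TOpp (prepr x)).
Definition p_add x y := pclass (TAdd (prepr x) (prepr y)).
Definition p_mul x y := pclass (TMul (prepr x) (prepr y)).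

Lemma p_oppE t : p_opp (pclass t) = pclass (TOpp t).
Proof. exact/pclassP/cong_opp/prepr_cong. Qed.
Lemma p_addE t u : p_add (pclass t) (pclass u) = pclass (TAdd t u).
Proof. by apply/pclassP/cong_add; apply: prepr_cong. Qed.
Lemma p_mulE t u : p_mul (pclass t) (pclass u) = pclass (TMul t u).
Proof. by apply/pclassP/cong_mul; apply: prepr_cong. Qed.

Let pE := (p_oppE, p_addE, p_mulE).

Fact p_addA : associative p_add.
Proof.
elim/presented_ind=> t; elim/presented_ind=> u; elim/presented_ind=> w.
by rewrite !pE; apply/pclassP/cong_addA.
Qed.
Fact p_addC : commutative p_add.
Proof.
elim/presented_ind=> t; elim/presented_ind=> u.
by rewrite !pE; apply/pclassP/cong_addC.
Qed.
Fact p_add0 : left_id (pclass (TConst 0)) p_add.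
Proof. by elim/presented_ind=> t; rewrite !pE; apply/pclassP/cong_add0. Qed.
Fact p_addN : left_inverse (pclass (TConst 0)) p_opp p_add.
Proof. by elim/presented_ind=> t; rewrite !pE; apply/pclassP/cong_addN. Qed.

HB.instance Definition _ :=
  GRing.isZmodule.Build presented_alg p_addA p_addC p_add0 p_addN.

Fact p_mulA : associative p_mul.
Proof.
elim/presented_ind=> t; elim/presented_ind=> u; elim/presented_ind=> w.
by rewrite !pE; apply/pclassP/cong_mulA.
Qed.
Fact p_1mul : left_id (pclass (TConst 1)) p_mul.
Proof. by elim/presented_ind=> t; rewrite !pE; apply/pclassP/cong_1mul. Qed.
Fact p_mul1 : right_id (pclass (TConst 1)) p_mul.
Proof.
elim/presented_ind=> t; rewrite !pE; apply/pclassP.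
exact: cong_trans (cong_sym (cong_constC _ _)) (cong_1mul _).
Qed.
Fact p_mulDl : left_distributive p_mul p_add.
Proof.
elim/presented_ind=> t; elim/presented_ind=> u; elim/presented_ind=> w.
by rewrite !pE; apply/pclassP/cong_mulDl.
Qed.
Fact p_mulDr : right_distributive p_mul p_add.
Proof.
elim/presented_ind=> t; elim/presented_ind=> u; elim/presented_ind=> w.
by rewrite !pE; apply/pclassP/cong_mulDr.
Qed.

HB.instance Definition _ := GRing.Zmodule_isPzRing.Build presented_alg
  p_mulA p_1mul p_mul1 p_mulDl p_mulDr.

Definition p_const (r : R) : presented_alg := pclass (TConst r).

Fact p_const_add : {morph p_const : r s / r + s}.
Proof. by move=> r s; rewrite [RHS]p_addE; apply/pclassP/cong_constD. Qed.
Fact p_const_monoid : monoid_morphism p_const.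
Proof.
by split=> // r s; rewrite [RHS]p_mulE; apply/pclassP/cong_constM.
Qed.
Fact p_const_central r x : p_const r * x = x * p_const r.
Proof.
elim/presented_ind: x => t.
by rewrite [LHS]p_mulE [RHS]p_mulE; apply/pclassP/cong_constC.
Qed.

HB.instance Definition _ := isPzAlgebra.Build R presented_alg
  p_const_add p_const_monoid p_const_central.

Definition pgen (g : G) : presented_alg := pclass (TGen g).

Lemma pclass_eval t : term_eval pgen t = pclass t.
Proof.
elim: t => //= [t ->|t -> u ->|t -> u ->].
- exact: p_oppE.
- exact: p_addE.
- exact: p_mulE.
Qed.

Lemma pgen_rel t u : rel t u -> term_eval pgen t = term_eval pgen u.
Proof. by move=> tu; rewrite !pclass_eval; apply/pclassP/cong_rel. Qed.

Section Universal.
Variables (B : pzAlgType R) (v : G -> B).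

Definition satisfies_rel : Prop :=
  forall t u, rel t u -> term_eval v t = term_eval v u.

Definition presented_lift of satisfies_rel :=
  fun x : presented_alg => term_eval v (prepr x) : B.

Hypothesis v_rel : satisfies_rel.
Local Notation lift := (presented_lift v_rel).

Lemma term_eval_cong t u : term_cong t u -> term_eval v t = term_eval v u.
Proof.
elim=> //= {t u}.
- by move=> t u w _ -> _ ->.
- by move=> t u _ ->.
- by move=> t u t' u' _ -> _ ->.
- by move=> t u t' u' _ -> _ ->.
- by move=> t u w; rewrite addrA.
- by move=> t u; rewrite addrC.
- by move=> t; rewrite alg_const0 add0r.
- by move=> t; rewrite alg_const0 addNr.
- by move=> t u w; rewrite mulrA.
- by move=> t; rewrite alg_const1 mul1r.
- by move=> t u w; rewrite mulrDl.
- by move=> t u w; rewrite mulrDr.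
- by move=> r s; rewrite alg_const_add.
- by move=> r s; rewrite alg_constM.
- by move=> r t; rewrite alg_const_central.
Qed.

Lemma presented_liftE t : lift (pclass t) = term_eval v t.
Proof. exact/term_eval_cong/prepr_cong. Qed.

Lemma presented_lift_gen g : lift (pgen g) = v g.
Proof. exact: presented_liftE. Qed.

Fact presented_lift_additive : zmod_morphism lift.
Proof.
elim/presented_ind=> t; elim/presented_ind=> u.
have -> : pclass t - pclass u = pclass (TAdd t (TOpp u)).
  by rewrite -p_addE -p_oppE.
by rewrite !presented_liftE.
Qed.

Fact presented_lift_monoid : monoid_morphism lift.
Proof.
split; first by rewrite [LHS](presented_liftE (TConst 1)) /= alg_const1.
elim/presented_ind=> t; elim/presented_ind=> u.
by rewrite [_ * _]p_mulE !presented_liftE.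
Qed.

HB.instance Definition _ := GRing.isZmodMorphism.Build presented_alg B
  lift presented_lift_additive.
HB.instance Definition _ := GRing.isMonoidMorphism.Build presented_alg B
  lift presented_lift_monoid.

Lemma presented_lift_const : algebra_morphism lift.
Proof. by move=> r; rewrite [LHS](presented_liftE (TConst r)). Qed.

Lemma presented_lift_unique (f : {rmorphism presented_alg -> B}) :
  algebra_morphism f -> (forall g, f (pgen g) = v g) -> f =1 lift.
Proof.
move=> fC fg; elim/presented_ind=> t; rewrite presented_liftE.
elim: t => //= [t <-|t <- u <-|t <- u <-].
- by rewrite -p_oppE -raddfN.
- by rewrite -p_addE -raddfD.
- by rewrite -p_mulE -rmorphM.
Qed.

End Universal.

End Presentation.

Section Subshift.
Variable A : Type.

(* x 0, x 1, x 2, ... are the letters x_1, x_2, x_3, ... of x.                *)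
Definition infword : Type := nat -> A.

HB.instance Definition _ := gen_eqMixin infword.
HB.instance Definition _ := gen_choiceMixin infword.

Implicit Types (x y z : infword) (w al be : seq A).

Definition shift x : infword := fun n => x n.+1.

Definition icons (a : A) x : infword := fun n => if n is m.+1 then x m else a.

Definition icat w x : infword := foldr icons x w.

Definition factor x (i n : nat) : seq A := [seq x j | j <- iota i n].

Variable F : set (seq A).

Definition subshift : set infword := [set x | forall i n, ~ F (factor x i n)].

Definition language : set (seq A) :=
  [set w | exists x i n, subshift x /\ factor x i n = w].

Definition cylinder al be : set subshift :=
  [set y | exists x, val y = icat be x /\ subshift (icat al x)].

Definition boolean_algebra (T : Type) (B : set (set T)) : Prop :=
  [/\ B [set: T],
      (forall D, B D -> B (~` D)),
      (forall D E, B D -> B E -> B (D `&` E))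
    & (forall D E, B D -> B E -> B (D `|` E))].

Definition cylinder_algebra : set (set subshift) :=
  smallest (@boolean_algebra subshift)
           [set cylinder al be | al in language & be in language].

(* GenP D, GenS a and GenS' a stand for p_D, s_a and s_a^*.                   *)
Inductive sub_gen : Type :=
| GenP of cylinder_algebra
| GenS of A
| GenS' of A.

Section Relations.
Variable R : comPzRingType.

Local Notation term := (alg_term R sub_gen).
Local Notation p D := (TGen R (GenP D)).
Local Notation s a := (TGen R (GenS a)).
Local Notation s' a := (TGen R (GenS' a)).
Local Notation "t ** u" := (TMul t u) (at level 40, left associativity).
Local Notation "t ++' u" := (TAdd t u) (at level 50, left associativity).
Local Notation "t --' u" := (TAdd t (TOpp u)) (at level 50, left associativity).

Definition s_word al : term := foldr (fun a t => s a ** t) (TConst _ 1) al.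
Definition s'_word al : term := foldr (fun a t => t ** s' a) (TConst _ 1) al.

(* Members of the Boolean algebra are named through their underlying sets, so *)
(* that no closure proof occurs in a relation; closure provides them all.     *)
Inductive sub_rel : term -> term -> Prop :=
| rel_pT (D : cylinder_algebra) :
    val D = [set: subshift] -> sub_rel (p D) (TConst _ 1)
| rel_pI (D E DE : cylinder_algebra) :
    val DE = val D `&` val E -> sub_rel (p DE) (p D ** p E)
| rel_pU (D E DE DuE : cylinder_algebra) :
    val DE = val D `&` val E -> val DuE = val D `|` val E ->
    sub_rel (p DuE) (p D ++' p E --' p DE)
| rel_p0 (D : cylinder_algebra) : val D = set0 -> sub_rel (p D) (TConst _ 0)
| rel_ss's a : sub_rel (s a ** s' a ** s a) (s a)
| rel_s'ss' a : sub_rel (s' a ** s a ** s' a) (s' a)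
| rel_cylinder al be (D : cylinder_algebra) :
    language al -> language be -> val D = cylinder al be ->
    sub_rel (s_word be ** s'_word al ** s_word al ** s'_word be) (p D).

Definition subshift_alg : Type := presented_alg sub_rel.

HB.instance Definition _ := PzAlgebra.copy subshift_alg (presented_alg sub_rel).

End Relations.

Lemma factor_icons a x i n : factor (icons a x) i.+1 n = factor x i n.
Proof.
rewrite /factor; have -> : i.+1 = (1 + i)%N by [].
by rewrite iotaDl -map_comp.
Qed.

Lemma subshift_tail a x : subshift (icons a x) -> subshift x.
Proof. by move=> Xax i n; rewrite -(factor_icons a); apply: Xax. Qed.

Lemma icons_shift x : icons (x 0%N) (shift x) = x.
Proof. by apply/funext; case. Qed.

Lemma subshift_shift x : subshift x -> subshift (shift x).
Proof. by move=> Xx; apply: (@subshift_tail (x 0%N)); rewrite icons_shift. Qed.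

Definition subshift_shiftT (x : subshift) : subshift :=
  SigSub (mem_set (subshift_shift (set_mem (valP x)))).

Section Representation.
Variable R : comPzRingType.

Local Notation P := (free_module R subshift).
Local Notation delta := (@delta R subshift).
Local Notation EndP := (@module_end R R P).

Definition free_end (f : subshift -> P) : EndP := mk_end (free_ext_linear f).

Definition opP (D : set subshift) : EndP :=
  free_end (fun x : subshift => if x \in D then delta x else 0).

Definition opS (a : A) : EndP :=
  free_end (fun x : subshift =>
    if (insub (icons a (val x)) : option subshift) is Some ax
    then delta ax else 0).

Definition opS' (a : A) : EndP :=
  free_end (fun x : subshift =>
    if `[< val x 0%N = a >] then delta (subshift_shiftT x) else 0).

Definition op_gen (g : sub_gen) : EndP :=
  match g with
  | GenP D => opP (val D)
  | GenS a => opS a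
  | GenS' a => opS' a
  end.

Implicit Types (xX : subshift) (f g : EndP).

Lemma free_endE (phi : subshift -> P) xX :
  end_app (free_end phi) (delta xX) = phi xX.
Proof. exact: free_ext_delta. Qed.

Lemma end_app0 f : end_app f 0 = 0.
Proof. exact: linear0. Qed.

Lemma free_endP f g :
  (forall xX, end_app f (delta xX) = end_app g (delta xX)) -> f = g.
Proof.
move=> fg; apply: module_endP => p; rewrite (free_expand p).
rewrite !linear_sum; apply: eq_bigr => k _.
by rewrite !linearZ_LR /= fg.
Qed.

Local Notation ev := (@term_eval R sub_gen EndP op_gen).

Lemma subshiftP xX : subshift (val xX).
Proof. exact/set_mem/valP. Qed.

Lemma subshift_icat w x : subshift (icat w x) -> subshift x.
Proof. by elim: w => //= a w IHw /subshift_tail/IHw. Qed.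

Lemma icons_inj a x y : icons a x = icons a y -> x = y.
Proof. by move=> /(congr1 shift). Qed.

Lemma icat_inj w x y : icat w x = icat w y -> x = y.
Proof. by elim: w => //= a w IHw /icons_inj. Qed.

Lemma s_word_delta w xX : end_app (ev (s_word R w)) (delta xX) =
  if (insub (icat w (val xX)) : option subshift) is Some y then delta y else 0.
Proof.
elim: w => [|a w IHw] /=; first by rewrite alg_const1 end1E valK.
rewrite endME IHw; case: insubP => [y _ yE|nX].
  by rewrite free_endE yE.
rewrite end_app0; case: insubP => // y Xy yE; case/negP: nX.
by apply/mem_set/(@subshift_tail a)/set_mem.
Qed.

Lemma s'_word_icat w xX (yX : subshift) : val xX = icat w (val yX) ->
  end_app (ev (s'_word R w)) (delta xX) = delta yX.
Proof.
elim: w xX => [|a w IHw] xX /= xE.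
  by rewrite alg_const1 end1E; congr delta; apply: val_inj.
rewrite endME free_endE asboolT; last by rewrite /= xE.
apply: IHw.
by rewrite /subshift_shiftT /= xE.
Qed.

Lemma s'_word_nicat w xX :
  (forall yX : subshift, val xX <> icat w (val yX)) ->
  end_app (ev (s'_word R w)) (delta xX) = 0.
Proof.
elim: w xX => [|a w IHw] xX /= xE; first by case: (xE xX).
rewrite endME free_endE; case: asboolP => [x0|_]; last exact: end_app0.
apply: IHw => yX xw; apply: (xE yX); rewrite -xw -x0.
by rewrite /= icons_shift.
Qed.

Lemma op_gen_rel : satisfies_rel (@sub_rel R) op_gen.
Proof.
move=> t u; case=> {t u} /=.
- move=> D DE; apply: free_endP => x; rewrite free_endE alg_const1 end1E.
  by rewrite DE in_setT.
- move=> D E DE DEE; apply: free_endP => x.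
  rewrite endME !free_endE DEE in_setI; case: (x \in val E).
    by rewrite andbT free_endE.
  by rewrite andbF end_app0.
- move=> D E DE DuE DEE DuEE; apply: free_endP => x.
  rewrite !endDE endNE !free_endE DEE DuEE in_setI in_setU.
  by case: (x \in val D); case: (x \in val E);
     rewrite /= ?subr0 ?addr0 ?add0r ?addrK.
- move=> D DE; apply: free_endP => x.
  by rewrite free_endE alg_const0 end0E DE in_set0.
- move=> a; apply: free_endP => x; rewrite !endME !free_endE.
  case: insubP => [y _ yE|_]; last by rewrite !end_app0.
  rewrite free_endE asboolT; last by rewrite yE.
  rewrite free_endE /= yE.
  by case: insubP => [z _ zE|]; [congr delta; apply: val_inj; rewrite zE yE|
    rewrite -[icons _ _]yE (valP y)].
- move=> a; apply: free_endP => x; rewrite !endME !free_endE.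
  case: asboolP => [x0|_]; last by rewrite !end_app0.
  rewrite free_endE /= -x0 icons_shift valK free_endE.
  by case: asboolP => // /(_ erefl).
- move=> al be D _ _ DE; apply: free_endP => x; rewrite !endME free_endE DE.
  have [[z xz]|nz] := pselect (exists z : subshift, val x = icat be (val z)).
    rewrite (s'_word_icat xz) s_word_delta.
    case: insubP => [y Xy yE|nX].
      rewrite (s'_word_icat yE) s_word_delta -xz valK mem_set //.
      by exists (val z); split=> //; apply: set_mem.
    rewrite !end_app0 memNset // => -[z' [xz' Xz']]; case/negP: nX.
    by apply/mem_set; rewrite (icat_inj (etrans (esym xz) xz')).
  rewrite s'_word_nicat; last by move=> y xy; apply: nz; exists y.
  rewrite !end_app0 memNset // => -[z [xz _]]; apply: nz.
  have Xz : subshift z by apply: (@subshift_icat be); rewrite -xz; apply: subshiftP.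
  by exists (SigSub (mem_set Xz)).
Qed.

Definition sub_rep : subshift_alg R -> EndP := presented_lift op_gen_rel.

HB.instance Definition _ := GRing.RMorphism.copy sub_rep
  (presented_lift op_gen_rel).

Lemma sub_rep_algebra : algebra_morphism sub_rep.
Proof. exact: presented_lift_const. Qed.

Lemma sub_rep_gen (g : sub_gen) : sub_rep (pgen _ g) = op_gen g.
Proof. exact: presented_lift_gen. Qed.

Definition tail_equiv (x y : subshift) : Prop :=
  exists n m, iter n shift (val x) = iter m shift (val y).

Variable x0 : subshift.

Definition submodule (N : set P) : Prop :=
  N 0 /\ forall (r : R) p q, N p -> N q -> N (r *: p + q).

Definition orbit_span : set P :=
  smallest submodule [set delta y | y in tail_equiv x0].

Lemma orbit_span_submod : submodule orbit_span.
Proof.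
split=> [N [[]]//|r p q sp sq N [Nsub Ndelta]].
by apply: Nsub.2; [apply: sp|apply: sq].
Qed.

Lemma orbit_span_delta (y : subshift) : tail_equiv x0 y -> orbit_span (delta y).
Proof. by move=> xy N [_]; apply; exists y. Qed.

Lemma orbit_span_gen (g : sub_gen) p :
  orbit_span p -> orbit_span (end_app (op_gen g) p).
Proof.
pose N : set P := [set p | orbit_span (end_app (op_gen g) p)].
have [S0 SL] := orbit_span_submod.
apply: (_ : orbit_span `<=` N); apply: smallest_sub => [|_ [y xy <-]].
  split=> [|r u v]; rewrite /N /=; first by rewrite end_app0.
  by move=> su sv; rewrite end_appP; apply: SL.
rewrite /N {N} /=; case: g => [D|a|a] /=; rewrite free_endE.
- by case: ifP => // _; apply: orbit_span_delta.
- case: insubP => // z _ zE; apply: orbit_span_delta.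
  by case: xy => n [m nm]; exists n, m.+1; rewrite iterSr zE.
- case: asboolP => // _; apply: orbit_span_delta.
  by case: xy => n [m nm]; exists n.+1, m; rewrite iterS nm -iterS iterSr.
Qed.

Lemma orbit_span_rep (mu : subshift_alg R) p :
  orbit_span p -> orbit_span (end_app (sub_rep mu) p).
Proof.
have [s0 sZD] := orbit_span_submod.
elim/presented_ind: mu p => t p; rewrite [sub_rep _](presented_liftE op_gen_rel).
elim: t p => [g|r|t IHt|t IHt u IHu|t IHt u IHu] p sp.
- exact: orbit_span_gen.
- have -> : end_app (ev (TConst _ r)) p = r *: p + 0 by rewrite addr0.
  exact: sZD.
- have -> : end_app (ev (TOpp t)) p = -1 *: end_app (ev t) p + 0.
    by rewrite scaleN1r addr0.
  by apply: sZD => //; apply: IHt.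
- have -> : end_app (ev (TAdd t u)) p = 1 *: end_app (ev t) p + end_app (ev u) p.
    by rewrite scale1r.
  by apply: sZD; [apply: IHt|apply: IHu].
- exact: IHt (IHu _ sp).
Qed.

Definition orbit_module : Type := orbit_span.

HB.instance Definition _ := SubType.copy orbit_module (set_type orbit_span).
HB.instance Definition _ := Choice.copy orbit_module (set_type orbit_span).

Fact orbit_zmod_closed : zmod_closed (mem orbit_span).
Proof.
have [s0 sZD] := orbit_span_submod.
split=> [|p q]; rewrite ?inE // => sp sq.
by rewrite addrC -scaleN1r; apply: sZD.
Qed.

HB.instance Definition _ := GRing.SubChoice_isSubZmodule.Build P (mem orbit_span)
  orbit_module orbit_zmod_closed.

Definition orbit_act (mu : subshift_alg R) (z : orbit_module) : orbit_module :=
  SigSub (mem_set (orbit_span_rep mu (set_mem (valP z)))).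

Implicit Types (m : orbit_module) (mu nu : subshift_alg R).

Lemma orbit_actE mu m : val (orbit_act mu m) = end_app (sub_rep mu) (val m).
Proof. by []. Qed.

Lemma orbit_valD (m n : orbit_module) : val (m + n) = val m + val n.
Proof. by []. Qed.

Fact orbit_actA mu nu m : orbit_act mu (orbit_act nu m) = orbit_act (mu * nu) m.
Proof. by apply: val_inj; rewrite !orbit_actE rmorphM. Qed.
Fact orbit_act1 : left_id 1 orbit_act.
Proof. by move=> m; apply: val_inj; rewrite orbit_actE rmorph1. Qed.
Fact orbit_actDr : right_distributive orbit_act +%R.
Proof.
move=> mu m n; apply: val_inj.
by rewrite orbit_valD !orbit_actE orbit_valD raddfD.
Qed.
Fact orbit_actDl m : {morph orbit_act^~ m : mu nu / mu + nu}.
Proof.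
by move=> mu nu; apply: val_inj; rewrite orbit_valD !orbit_actE raddfD.
Qed.

HB.instance Definition _ := GRing.Zmodule_isLmodule.Build (subshift_alg R)
  orbit_module orbit_actA orbit_act1 orbit_actDr orbit_actDl.

Lemma orbit_module_const (r : R) m :
  val ((alg_const r : subshift_alg R) *: m) = r *: val m.
Proof. by rewrite [LHS]orbit_actE sub_rep_algebra. Qed.

End Representation.

End Subshift.

(* Main.v *)
(* Cylinder sets separate the points of X, so an endomorphism f commuting     *)
(* with every p_D sends delta_y to c_y delta_y.  Applying s_a^* with a the    *)
(* first letter of y gives c_y = c_(sigma y), so c is constant on the tail    *)
(* equivalence class and f is multiplication by a scalar.                     *)
Require Import Defs.
From HB Require Import structures.
From mathcomp Require Import all_boot all_algebra boolp classical_sets.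

Set Implicit Arguments.
Unset Strict Implicit.
Unset Printing Implicit Defensive.

Import GRing.Theory.
Local Open Scope ring_scope.
Local Open Scope classical_set_scope.

(** Let [f] be an endomorphism and [y] a point of the class. For [z <> y], [separating_cylinder]
    gives [D] such that [p_D] fixes [delta y] and kills [delta z]; since [f] commutes with [p_D],
    [f (delta y)] has no [z]-coefficient, so it is [c_y *: delta y] ([scales_delta_ex]). Commuting
    with [s_a^*] gives [c_y = c_(sigma y)] ([scales_delta_shift]), and tail-equivalent points share
    an iterate, so [c] is constant ([scales_delta_orbit]). As the [delta y] span, [f] is this scalar
    ([scales_delta_const]), which a coefficient of [f (delta x0)] recovers. *)

Lemma iter_shift0 (A : Type) (x : infword A) i : iter i (@shift A) x 0%N = x i.
Proof. by elim: i x => [//|i IHi] x; rewrite iterSr IHi. Qed.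

Lemma icat_factor (A : Type) (x : infword A) i n :
  icat (factor x i n) (iter (i + n) (@shift A) x) = iter i (@shift A) x.
Proof.
elim: n i => [|n IHn] i; first by rewrite addn0.
rewrite addnS -addSn /factor /= [X in icons _ X]IHn iterS -(iter_shift0 x).
exact: icons_shift.
Qed.

Lemma icat_nth (A : Type) (w : seq A) (x y : infword A) n :
  (n < size w)%N -> icat w x n = icat w y n.
Proof. by elim: w n => [//|a w IHw] [|n] //=; apply: IHw. Qed.

Lemma separating_cylinder (A : Type) (F : set (seq A)) (y z : subshift F) :
  z <> y -> exists D : @cylinder_algebra A F, y \in val D /\ z \notin val D.
Proof.
move=> zy; have [n zyn] : exists n, val z n <> val y n.
  apply: contrapT => /forallNP zyE; apply/zy/val_inj/funext => n.
  exact: contrapT (zyE n).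
pose w := factor (val y) 0 n.+1.
have yE : icat w (iter n.+1 (@shift A) (val y)) = val y.
  exact: icat_factor (val y) 0%N n.+1.
(* With first word empty, the cylinder consists of the points of X beginning with [w], a prefix of
   [y] long enough to include the letter where [z] differs. *)
have Uw : cylinder_algebra (@cylinder A F [::] w).
  apply: sub_gen_smallest; exists [::].
    by exists (val y), 0%N, 0%N; split=> //; apply: subshiftP.
  by exists w => //; exists (val y), 0%N, n.+1; split=> //; apply: subshiftP.
exists (SigSub (mem_set Uw)); split=> /=.
  apply/mem_set; exists (iter n.+1 (@shift A) (val y)); split; first by rewrite yE.
  by apply: (@subshift_icat _ _ w); rewrite yE; apply: subshiftP.
apply/negP => /set_mem [u [zE _]]; apply: zyn; rewrite zE -[RHS](congr1 (@^~ n) yE).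
by apply: icat_nth; rewrite size_map size_iota.
Qed.

Lemma free_coef0 (R : comPzRingType) (K : choiceType) (k : K) :
  free_coef k (0 : free_module R K) = 0.
Proof. by rewrite -[X in free_coef k X](scale0r 0) free_coefZ mul0r. Qed.

Lemma free_coef_sum (R : comPzRingType) (K : choiceType) (k : K) (I : Type)
    (r : seq I) (p : I -> free_module R K) :
  free_coef k (\sum_(i <- r) p i) = \sum_(i <- r) free_coef k (p i).
Proof. exact: (big_morph _ (free_coefD k) (free_coef0 R k)). Qed.

Lemma free_coef_opP (A : Type) (R : comPzRingType) (F : set (seq A))
    (D : set (subshift F)) (z : subshift F) (p : free_module R (subshift F)) :
  z \notin D -> free_coef z (end_app (opP R D) p) = 0.
Proof.
move=> zD; rewrite [end_app _ _]/(free_ext _ _) free_coef_sum big1 // => k _.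
rewrite free_coefZ; case: ifP => [kD|_]; last by rewrite free_coef0 mulr0.
rewrite free_coef_delta; case: eqP => [kz|_]; last by rewrite mulr0.
by rewrite kz (negbTE zD) in kD.
Qed.

Section OrbitModule.
Variables (A : Type) (R : comPzRingType) (F : set (seq A)) (x0 : subshift F).

Local Notation M := (orbit_module R x0).
Local Notation alg := (subshift_alg F R).
Local Notation delta := (@delta R (subshift F)).
Local Notation shiftT := (@subshift_shiftT A F).
Implicit Types (y z : subshift F) (f : @module_end R alg M) (c : R).

Definition orbit_delta y (xy : tail_equiv x0 y) : M :=
  SigSub (mem_set (@orbit_span_delta _ _ R _ _ xy)).

(** Linearity of [f] over the generator [g], read in the ambient free module, where the action is
    explicit. *)
Lemma end_orbit_gen f (g : sub_gen F) (m m' : M) :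
  val m' = end_app (op_gen R g) (val m) ->
  val (end_app f m') = end_app (op_gen R g) (val (end_app f m)).
Proof.
move=> m'E; pose s : alg := pgen _ g.
have -> : m' = s *: m by apply: val_inj; rewrite m'E [RHS]orbit_actE sub_rep_gen.
by rewrite [end_app f _](linearZ_LR (f : {linear M -> M})) [LHS]orbit_actE
  sub_rep_gen.
Qed.

(** Quantifying over [m] spares carrying a proof that [delta y] lies in the span. *)
Definition scales_delta f c y : Prop :=
  forall m : M, val m = delta y -> val (end_app f m) = c *: delta y.

Lemma scales_delta_inj f c c' y : tail_equiv x0 y ->
  scales_delta f c y -> scales_delta f c' y -> c = c'.
Proof.
move=> xy /(_ (orbit_delta xy) erefl) fc /(_ (orbit_delta xy) erefl).
rewrite fc => /(congr1 (free_coef y)).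
by rewrite !free_coefZ free_coef_delta eqxx !mulr1.
Qed.

Lemma scales_delta_ex f y : tail_equiv x0 y -> exists c, scales_delta f c y.
Proof.
move=> xy; exists (free_coef y (val (end_app f (orbit_delta xy)))) => m my.
have -> : orbit_delta xy = m by apply: val_inj; rewrite my.
apply: free_moduleP => z; rewrite free_coefZ free_coef_delta.
case: eqP => [->|/nesym zy]; first by rewrite mulr1.
have [D [yD zD]] := separating_cylinder zy.
(* Here [m] is its own image under [p_D], so [f m] is too. *)
rewrite mulr0 (@end_orbit_gen f (GenP D) m m) ?free_coef_opP //.
by rewrite my free_endE yD.
Qed.

Lemma tail_equiv_shift y : tail_equiv x0 y -> tail_equiv x0 (shiftT y).
Proof. by case=> n [m nm]; exists n.+1, m; rewrite iterS nm -iterS iterSr. Qed.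

Lemma scales_delta_shift f c y : tail_equiv x0 y ->
  scales_delta f c y <-> scales_delta f c (shiftT y).
Proof.
move=> xy; have fwd c' : scales_delta f c' y -> scales_delta f c' (shiftT y).
  move=> fy m mE.
  have S'E : end_app (op_gen R (GenS' F (val y 0%N))) (delta y) =
      delta (shiftT y) by rewrite free_endE asboolT.
  rewrite (@end_orbit_gen f (GenS' F (val y 0%N)) (orbit_delta xy)).
    by rewrite (fy (orbit_delta xy) erefl) linearZ_LR; congr (c' *: _).
  by rewrite mE -S'E.
split=> [|fsy]; first exact: fwd.
(* The converse needs no [s_a]: [y] has some scalar [c'], which passes forward to its shift and
   equals [c] by uniqueness there. *)
have [c' fy] := scales_delta_ex f xy.
by rewrite (scales_delta_inj (tail_equiv_shift xy) fsy (fwd _ fy)).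
Qed.

Lemma scales_delta_iter f c n y : tail_equiv x0 y ->
  scales_delta f c y <-> scales_delta f c (iter n shiftT y).
Proof.
elim: n y => [//|n IHn] y xy; rewrite iterSr scales_delta_shift // IHn //.
exact: tail_equiv_shift.
Qed.

Lemma val_iter_shiftT n y : val (iter n shiftT y) = iter n (@shift A) (val y).
Proof. by elim: n => //= n ->. Qed.

Lemma tail_equiv_refl : tail_equiv x0 x0.
Proof. by exists 0%N, 0%N. Qed.

Lemma scales_delta_orbit f c y : tail_equiv x0 y ->
  scales_delta f c x0 -> scales_delta f c y.
Proof.
move=> xy fx; have [n [m nm]] := xy; apply/(scales_delta_iter f c m xy).
have <- : iter n shiftT x0 = iter m shiftT y.
  by apply: val_inj; rewrite !val_iter_shiftT.
exact/(scales_delta_iter f c n tail_equiv_refl).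
Qed.

Lemma scales_delta_const f c : scales_delta f c x0 -> f = alg_const c.
Proof.
move=> fx; apply: module_endP => m; rewrite endCE; apply: val_inj.
rewrite orbit_module_const.
(* Membership in the span is part of [N] so that summands lift to the module, where [f] is
   additive. *)
pose N : set (free_module R (subshift F)) := [set p | orbit_span x0 p /\
  forall m : M, val m = p -> val (end_app f m) = c *: p].
have [S0 SL] := orbit_span_submod R x0.
suff /(_ _ (set_mem (valP m))) [_] : orbit_span x0 `<=` N by apply.
apply: smallest_sub => [|_ [y xy <-]]; last first.
  by split; [apply: orbit_span_delta|apply: scales_delta_orbit].
split=> [|r p q [Sp fp] [Sq fq]].
  split=> // m' m'E; have -> : m' = 0 by apply: val_inj.
  by rewrite [end_app f 0](linear0 (f : {linear M -> M})) scaler0.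
split=> [|m' m'E]; first exact: SL.
pose u : M := SigSub (mem_set Sp); pose v : M := SigSub (mem_set Sq).
have -> : m' = (alg_const r : alg) *: u + v.
  by apply: val_inj; rewrite orbit_valD orbit_module_const m'E.
rewrite end_appP orbit_valD orbit_module_const (fp u) // (fq v) //.
by rewrite scalerDr !scalerA mulrC.
Qed.

Definition end_coef f : R :=
  free_coef x0 (val (end_app f (orbit_delta tail_equiv_refl))).

Lemma end_constK : cancel alg_const end_coef.
Proof.
move=> c; rewrite /end_coef endCE orbit_module_const free_coefZ.
by rewrite free_coef_delta eqxx mulr1.
Qed.

Lemma end_coefK : cancel end_coef alg_const.
Proof.
move=> f; have [c /scales_delta_const ->] := scales_delta_ex f tail_equiv_refl.
by rewrite end_constK.
Qed.

(** Additivity is inherited from the inverse map [alg_const]. *)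
Fact end_coef_zmod : zmod_morphism end_coef.
Proof.
move=> f g; apply: (addIr (end_coef g)); apply: (can_inj end_constK).
by rewrite subrK alg_const_add !end_coefK subrK.
Qed.

Fact end_coef_monoid : monoid_morphism end_coef.
Proof.
split=> [|f g]; apply: (can_inj end_constK).
  by rewrite end_coefK alg_const1.
by rewrite alg_constM !end_coefK.
Qed.

HB.instance Definition _ := GRing.isZmodMorphism.Build (module_end M) R
  end_coef end_coef_zmod.
HB.instance Definition _ := GRing.isMonoidMorphism.Build (module_end M) R
  end_coef end_coef_monoid.

End OrbitModule.

Theorem proposition3p10 (A : Type) (A_nonempty : inhabited A)
    (R : comPzRingType) (F : set (seq A)) (x : subshift F) :
  algebra_isomorphic (R := R)
    (module_end (A := subshift_alg F R) (orbit_module R x)) R.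
Proof.
(* Fixing the scalars is the same identity as being a left inverse of [alg_const]. *)
exists (@end_coef A R F x); split; first exact: end_constK.
by exists alg_const; [exact: end_coefK|exact: end_constK].
Qed.
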